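(* Let $n,p$ be positive integers, $X\in\mathbb{R}^{n\times p}$, $Y\in\mathbb{R}^n$, $\gamma>0$, and let $\psi(X)\in\mathbb{R}^{n\times f}$ be the matrix of transformed features described in the context, with columns $\psi_1(X),\dots,\psi_f(X)\in\mathbb{R}^n$. Let $k\in\{1,\dots,f\}$. Then the sparse nonlinear regression problem $$\min_{\tilde w\in\mathbb{R}^f}\ \Big\{\tfrac{1}{2\gamma}\|\tilde w\|_2^2+\tfrac12\|Y-\psi(X)\tilde w\|_2^2\ :\ \|\tilde w\|_0\le k\Big\}$$ can be reformulated as the nonlinear optimization problem $$\min_{s\in S^f_k}\ \tfrac12\,Y^\top\Big(I_n+\gamma\sum_{j=1}^f s_jK_j\Big)^{-1}Y,\qquad K_j:=\psi_j(X)\psi_j(X)^\top;$$ that is, the two problems have the same optimal value.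
   Context: $\|\tilde w\|_0$ denotes the number of nonzero entries of $\tilde w$. $S^f_k:=\{s\in\{0,1\}^f : \sum_{j=1}^f s_j\le k\}$. $I_n$ is the $n\times n$ identity matrix. The matrix $\psi(X)\in\mathbb{R}^{n\times f}$, with $f=8p$, is obtained by applying entrywise to each column of $X$ each of the eight transformations $x,\ \sqrt{|x|},\ \log|x|,\ x^2,\ x^3,\ \cos(10\pi x),\ \sin(x),\ \tanh(2x)$, and taking the resulting $8p$ vectors as the columns $\psi_1(X),\dots,\psi_f(X)$. Any fixed real value may be assigned to $\log|0|$. *)

(* Defs.v *)
From HB Require Import structures.
From mathcomp Require Import all_boot all_order all_algebra.
From mathcomp Require Import all_classical all_reals all_analysis.
Set Implicit Arguments.
Unset Strict Implicit.
Unset Printing Implicit Defensive.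
Import Order.TTheory GRing.Theory Num.Theory.
Local Open Scope classical_set_scope.
Local Open Scope ring_scope.

Definition tanh (R : realType) (x : R) : R :=
  (expR x - expR (- x)) / (expR x + expR (- x)).

(* x |-> log |x|, with the arbitrary value c at 0. *)
Definition logabs (R : realType) (c x : R) : R :=
  if x == 0 then c else ln `|x|.

Definition transform (R : realType) (c : R) : 'I_8 -> R -> R :=
  tnth [tuple (fun x => x);
              (fun x => Num.sqrt `|x|);
              logabs c;
              (fun x => x ^+ 2);
              (fun x => x ^+ 3);
              (fun x => cos (10%:R * pi * x));
              (fun x => sin x);
              (fun x => tanh (2%:R * x))].

(* Column mxvec_index t l of psi c X is the t-th transformation applied to
   column l of X; every column is of this form for exactly one (t, l). *)
Definition psi (R : realType) (n p : nat) (c : R) (X : 'M[R]_(n, p)) :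
    'M[R]_(n, 8 * p) :=
  \matrix_(i < n) mxvec (\matrix_(t < 8, l < p) transform c t (X i l)).

(* The norm MathComp-Analysis puts on matrices is the max norm, not this one. *)
Definition norm2 (R : realType) (m : nat) (v : 'cV[R]_m) : R :=
  Num.sqrt (\sum_(i < m) v i 0 ^+ 2).

Definition norm0 (R : realType) (m : nat) (v : 'cV[R]_m) : nat :=
  #|[set i : 'I_m | v i 0 != 0]%SET|.

Definition sparse_supports (f k : nat) : set {ffun 'I_f -> bool} :=
  [set s : {ffun 'I_f -> bool} | (\sum_(j < f) s j <= k)%N].
Arguments sparse_supports f k : clear implicits.

Definition regression_objective (R : realType) (n f : nat) (gamma : R)
    (Y : 'cV[R]_n) (Psi : 'M[R]_(n, f)) (w : 'cV[R]_f) : R :=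
  1 / (2%:R * gamma) * norm2 w ^+ 2 + 1 / 2%:R * norm2 (Y - Psi *m w) ^+ 2.

Definition kernel_mx (R : realType) (n f : nat) (Psi : 'M[R]_(n, f))
    (j : 'I_f) : 'M[R]_n :=
  col j Psi *m (col j Psi)^T.

Definition support_mx (R : realType) (n f : nat) (gamma : R)
    (Psi : 'M[R]_(n, f)) (s : {ffun 'I_f -> bool}) : 'M[R]_n :=
  1%:M + gamma *: \sum_(j < f) (s j)%:R *: kernel_mx Psi j.

Definition support_objective (R : realType) (n f : nat) (gamma : R)
    (Y : 'cV[R]_n) (Psi : 'M[R]_(n, f)) (s : {ffun 'I_f -> bool}) : R :=
  1 / 2%:R * (Y^T *m invmx (support_mx gamma Psi s) *m Y) 0 0.

(* v = min {F x : x in D}; the minimum is attained. *)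
Definition is_min_value (R : realType) (T : Type) (D : set T) (F : T -> R)
    (v : R) : Prop :=
  ((F @` D) `&` lbound (F @` D)) v.

(* Main.v *)
Require Import Defs.
From HB Require Import structures.
From mathcomp Require Import all_boot all_order all_algebra.
From mathcomp Require Import all_classical all_reals all_analysis.
From mathcomp Require Import ring lra.
Set Implicit Arguments.
Unset Strict Implicit.
Unset Printing Implicit Defensive.
Import Order.TTheory GRing.Theory Num.Theory.
Local Open Scope classical_set_scope.
Local Open Scope ring_scope.

(** The equality of the two optimal values is linear algebra, carried out for a
    general feature matrix [Psi] with columns [psi_j].

    Fix a support [s] and let [M = 1 + gamma * sum_j s_j K_j].  As
    [a^T M a >= a^T a], the matrix [M] is invertible; put [a = M^-1 Y].  The
    ridge regression over the weights supported on [s] is solved by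
    [u_j = gamma * s_j * (Psi^T a)_j], because [M a = a + Psi u], so that [a] is
    the residual [Y - Psi u] and the formula for [u] is the stationarity
    condition.  Since the objective is quadratic, it can be expanded exactly
    around [u]: the linear terms cancel ([dot_features]), the constant term is
    [a^T M a / 2 = Y^T M^-1 Y / 2], and the quadratic part is the objective for
    the response 0 ([regression_objective_split]).  Hence the support objective
    at [s] is the minimum of the regression objective over the weights supported
    on [s].

    A vector has at most [k] nonzero entries exactly when it is supported on some
    [s] of size at most [k], so the sparse problem amounts to minimizing the
    support objective over the finite nonempty set of such [s]. *)

Definition dot {R : realType} {m : nat} (u v : 'cV[R]_m) : R :=
  (u^T *m v) 0 0.

Lemma dotE (R : realType) (m : nat) (u v : 'cV[R]_m) :
  dot u v = \sum_(i < m) u i 0 * v i 0.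
Proof. by rewrite /dot mxE; apply: eq_bigr => i _; rewrite mxE. Qed.

Lemma dotC (R : realType) (m : nat) (u v : 'cV[R]_m) : dot u v = dot v u.
Proof. by rewrite !dotE; apply: eq_bigr => i _; rewrite mulrC. Qed.

Lemma dotDr (R : realType) (m : nat) (u v w : 'cV[R]_m) :
  dot u (v + w) = dot u v + dot u w.
Proof. by rewrite /dot mulmxDr mxE. Qed.

Lemma dotDl (R : realType) (m : nat) (u v w : 'cV[R]_m) :
  dot (u + v) w = dot u w + dot v w.
Proof. by rewrite dotC dotDr !(dotC w). Qed.

Lemma dotNr (R : realType) (m : nat) (u v : 'cV[R]_m) : dot u (- v) = - dot u v.
Proof. by rewrite /dot mulmxN mxE. Qed.

Lemma dotNl (R : realType) (m : nat) (u v : 'cV[R]_m) : dot (- u) v = - dot u v.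
Proof. by rewrite dotC dotNr dotC. Qed.

Lemma dot_ge0 (R : realType) (m : nat) (u : 'cV[R]_m) : 0 <= dot u u.
Proof. by rewrite dotE; apply: sumr_ge0 => i _; rewrite -expr2 sqr_ge0. Qed.

Lemma dot_eq0 (R : realType) (m : nat) (u : 'cV[R]_m) : dot u u <= 0 -> u = 0.
Proof.
move=> u_le0; have : dot u u == 0 by rewrite eq_le u_le0 dot_ge0.
rewrite dotE psumr_eq0 => [/allP u0|i _]; last by rewrite -expr2 sqr_ge0.
apply/matrixP => i j; rewrite ord1 mxE.
by have := u0 i (mem_index_enum i); rewrite mulf_eq0 orbb => /eqP.
Qed.

Lemma sqr_norm2 (R : realType) (m : nat) (u : 'cV[R]_m) :
  norm2 u ^+ 2 = dot u u.
Proof.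
rewrite /norm2 sqr_sqrtr; last by apply: sumr_ge0 => i _; rewrite sqr_ge0.
by rewrite dotE; apply: eq_bigr => i _; rewrite expr2.
Qed.

Definition supported_on {R : realType} {f : nat} (s : {ffun 'I_f -> bool})
    (w : 'cV[R]_f) : Prop :=
  forall j, ~~ s j -> w j 0 = 0.

(** With [a = M^-1 Y] this is the ridge solution on the support [s]; it is kept
    as a function of the dual vector [a] because positivity of [M] uses it for
    an arbitrary [a]. *)
Definition dual_weights {R : realType} {n f : nat} (gamma : R)
    (Psi : 'M[R]_(n, f)) (s : {ffun 'I_f -> bool}) (a : 'cV[R]_n) : 'cV[R]_f :=
  \col_j (gamma * (s j)%:R * (Psi^T *m a) j 0).

Lemma dual_weights_supported (R : realType) (n f : nat) (gamma : R)
    (Psi : 'M[R]_(n, f)) (s : {ffun 'I_f -> bool}) (a : 'cV[R]_n) :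
  supported_on s (dual_weights gamma Psi s a).
Proof. by move=> j /negbTE sj; rewrite mxE sj mulr0 mul0r. Qed.

(** Each rank-one kernel acts by [K_j a = (psi_j . a) psi_j], so the regularized
    part of the matrix produces a combination of the selected features. *)
Lemma support_mx_mul (R : realType) (n f : nat) (gamma : R)
    (Psi : 'M[R]_(n, f)) (s : {ffun 'I_f -> bool}) (a : 'cV[R]_n) :
  support_mx gamma Psi s *m a = a + Psi *m dual_weights gamma Psi s a.
Proof.
rewrite /support_mx mulmxDl mul1mx -scalemxAl mulmx_suml; congr (_ + _).
apply/matrixP => i l; rewrite !ord1 !mxE summxE mulr_sumr.
apply: eq_bigr => j _; rewrite -scalemxAl /kernel_mx -mulmxA tr_col -row_mul.
by rewrite !mxE big_ord1 !mxE; ring.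
Qed.

(** Stationarity of the dual weights: the gradient of the penalty at
    [dual_weights a] balances the gradient of the squared error with residual
    [a], along every direction supported on [s]. *)
Lemma dot_features (R : realType) (n f : nat) (gamma : R) (hgamma : 0 < gamma)
    (Psi : 'M[R]_(n, f)) (s : {ffun 'I_f -> bool}) (a : 'cV[R]_n)
    (w : 'cV[R]_f) :
  supported_on s w ->
  dot a (Psi *m w) = gamma^-1 * dot (dual_weights gamma Psi s a) w.
Proof.
move=> sw; have -> : dot a (Psi *m w) = dot (Psi^T *m a) w.
  by rewrite /dot trmx_mul trmxK mulmxA.
rewrite !dotE mulr_sumr; apply: eq_bigr => j _.
rewrite [dual_weights _ _ _ _ _ _]mxE; have [sj|/sw ->] := boolP (s j).
  by rewrite mulr1 -mulrA mulKf ?gt_eqF.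
by rewrite !mulr0.
Qed.

Lemma dot_support_mx (R : realType) (n f : nat) (gamma : R) (hgamma : 0 < gamma)
    (Psi : 'M[R]_(n, f)) (s : {ffun 'I_f -> bool}) (a : 'cV[R]_n) :
  let u := dual_weights gamma Psi s a in
  dot a (support_mx gamma Psi s *m a) = dot a a + gamma^-1 * dot u u.
Proof.
have su := @dual_weights_supported _ _ _ gamma Psi s a.
by rewrite /= support_mx_mul dotDr (dot_features hgamma Psi a su).
Qed.

(** The matrix is positive definite, hence has a trivial kernel. *)
Lemma support_mx_unit (R : realType) (n f : nat) (gamma : R)
    (hgamma : 0 < gamma) (Psi : 'M[R]_(n, f)) (s : {ffun 'I_f -> bool}) :
  support_mx gamma Psi s \in unitmx.
Proof.
rewrite -unitmx_tr -row_free_unit; apply/inj_row_free => v vM0.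
have Ma0 : support_mx gamma Psi s *m v^T = 0.
  by apply: trmx_inj; rewrite trmx_mul trmxK vM0 trmx0.
have := dot_support_mx hgamma Psi s v^T.
rewrite /= Ma0 {1}/dot mulmx0 mxE => vv0.
apply: trmx_inj; rewrite trmx0; apply: dot_eq0.
have : 0 <= gamma^-1 * dot (dual_weights gamma Psi s v^T)
                           (dual_weights gamma Psi s v^T).
  by rewrite mulr_ge0 ?dot_ge0 // invr_ge0 ltW.
lra.
Qed.

Definition ridge_solution {R : realType} {n f : nat} (gamma : R) (Y : 'cV[R]_n)
    (Psi : 'M[R]_(n, f)) (s : {ffun 'I_f -> bool}) : 'cV[R]_f :=
  dual_weights gamma Psi s (invmx (support_mx gamma Psi s) *m Y).

(** Completing the square: the excess over the value at the minimizer is the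
    quadratic part of the objective, which is the objective for the response 0. *)
Lemma regression_objective_split (R : realType) (n f : nat) (gamma : R)
    (hgamma : 0 < gamma) (Y : 'cV[R]_n) (Psi : 'M[R]_(n, f))
    (s : {ffun 'I_f -> bool}) (w : 'cV[R]_f) :
  supported_on s w ->
  regression_objective gamma Y Psi w =
    support_objective gamma Y Psi s +
    regression_objective gamma 0 Psi (w - ridge_solution gamma Y Psi s).
Proof.
move=> sw; pose a := invmx (support_mx gamma Psi s) *m Y.
rewrite /ridge_solution -/a.
have Ma : support_mx gamma Psi s *m a = Y.
  by rewrite mulKVmx // support_mx_unit.
have aY := dot_support_mx hgamma Psi s a.
have saE := support_mx_mul gamma Psi s a.
have su := @dual_weights_supported _ _ _ gamma Psi s a.
move: aY saE su; rewrite /= Ma; set u := dual_weights _ _ _ _ => aY YE su.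
have sd : supported_on s (w - u).
  by move=> j sj; rewrite mxE sw // mxE su // subr0.
have cross := dot_features hgamma Psi a sd.
rewrite -/u in cross.
have -> : support_objective gamma Y Psi s = 1 / 2%:R * dot a Y.
  by rewrite /support_objective -mulmxA -/a -/(dot Y a) dotC.
rewrite /regression_objective !sqr_norm2 aY.
have -> : Y - Psi *m w = a - Psi *m (w - u).
  by rewrite YE mulmxBr opprB addrA.
have wE : w = u + (w - u) by rewrite addrC subrK.
rewrite {1 2}wE sub0r; move: (w - u) cross => d cross.
(* The terms linear in [d] enter the penalty and the squared error with opposite
   signs and cancel by [cross]. *)
rewrite !(dotDl, dotDr, dotNl, dotNr) (dotC d u) (dotC (Psi *m d) a) cross.
by field; rewrite gt_eqF.
Qed.

Lemma regression_objective_ge0 (R : realType) (n f : nat) (gamma : R)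
    (hgamma : 0 < gamma) (Y : 'cV[R]_n) (Psi : 'M[R]_(n, f)) (w : 'cV[R]_f) :
  0 <= regression_objective gamma Y Psi w.
Proof.
have h2 : 0 <= 1 / (2%:R * gamma) by rewrite divr_ge0 ?mulr_ge0 // ltW.
by rewrite addr_ge0 // mulr_ge0 ?sqr_ge0 // divr_ge0.
Qed.

Lemma support_objective_le (R : realType) (n f : nat) (gamma : R)
    (hgamma : 0 < gamma) (Y : 'cV[R]_n) (Psi : 'M[R]_(n, f))
    (s : {ffun 'I_f -> bool}) (w : 'cV[R]_f) :
  supported_on s w ->
  support_objective gamma Y Psi s <= regression_objective gamma Y Psi w.
Proof.
move=> sw; rewrite (regression_objective_split hgamma Y Psi sw).
by rewrite lerDl regression_objective_ge0.
Qed.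

Lemma regression_objective_ridge (R : realType) (n f : nat) (gamma : R)
    (hgamma : 0 < gamma) (Y : 'cV[R]_n) (Psi : 'M[R]_(n, f))
    (s : {ffun 'I_f -> bool}) :
  regression_objective gamma Y Psi (ridge_solution gamma Y Psi s) =
    support_objective gamma Y Psi s.
Proof.
have su := @dual_weights_supported _ _ _ gamma Psi s
  (invmx (support_mx gamma Psi s) *m Y).
rewrite (regression_objective_split hgamma Y Psi su).
rewrite subrr /regression_objective mulmx0 subr0 !sqr_norm2.
by rewrite /dot !mulmx0 !mxE !mulr0 !addr0.
Qed.

Lemma norm0_le_support (R : realType) (f : nat) (s : {ffun 'I_f -> bool})
    (w : 'cV[R]_f) :
  supported_on s w -> (norm0 w <= \sum_(j < f) s j)%N.
Proof.
move=> sw; rewrite /norm0 -sum1_card big_mkcond leq_sum // => j _.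
rewrite inE; case: eqVneq => //= wj; case: (boolP (s j)) => // /sw wj0.
by rewrite wj0 eqxx in wj.
Qed.

Definition support {R : realType} {f : nat} (w : 'cV[R]_f) :
    {ffun 'I_f -> bool} :=
  [ffun j => w j 0 != 0].

Lemma supported_on_support (R : realType) (f : nat) (w : 'cV[R]_f) :
  supported_on (support w) w.
Proof. by move=> j; rewrite ffunE negbK => /eqP. Qed.

Lemma sum_support (R : realType) (f : nat) (w : 'cV[R]_f) :
  (\sum_(j < f) support w j)%N = norm0 w.
Proof.
rewrite /norm0 -sum1_card [RHS]big_mkcond.
by apply: eq_bigr => j _; rewrite ffunE inE; case: (_ != _).
Qed.

(** The common value is attained at a best support [s] and, for the weights, at
    the ridge solution on [s]; the objective at a sparse [w] is bounded
    below through the support of [w]. *)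
Lemma sparse_regression_min (R : realType) (n f : nat) (gamma : R)
    (hgamma : 0 < gamma) (Y : 'cV[R]_n) (Psi : 'M[R]_(n, f)) (k : nat) :
  exists v : R,
    is_min_value [set w : 'cV[R]_f | (norm0 w <= k)%N]
      (regression_objective gamma Y Psi) v /\
    is_min_value (sparse_supports f k) (support_objective gamma Y Psi) v.
Proof.
pose P (s : {ffun 'I_f -> bool}) := (\sum_(j < f) s j <= k)%N.
have P0 : P [ffun => false] by rewrite /P big1 // => j _; rewrite ffunE.
have [s Ps smin] := arg_minP (support_objective gamma Y Psi) P0.
exists (support_objective gamma Y Psi s); split; split.
- exists (ridge_solution gamma Y Psi s); last exact: regression_objective_ridge.
  exact: leq_trans (norm0_le_support (@dual_weights_supported _ _ _ _ _ _ _)) Ps.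
- move=> _ [w /= wk <-].
  apply: le_trans (support_objective_le hgamma Y Psi (@supported_on_support _ _ w)).
  by apply: smin; rewrite /P sum_support.
- by exists s.
- by move=> _ [t /= tk <-]; exact: smin.
Qed.

Unset Implicit Arguments.

Theorem corollary1 (R : realType) (n p : nat) (hn : (0 < n)%N) (hp : (0 < p)%N)
    (c : R) (X : 'M[R]_(n, p)) (Y : 'cV[R]_n) (gamma : R) (hgamma : 0 < gamma)
    (k : nat) (hk : (1 <= k <= 8 * p)%N) :
  (forall s : {ffun 'I_(8 * p) -> bool}, sparse_supports (8 * p) k s ->
     support_mx gamma (psi c X) s \in unitmx) /\
  exists v : R,
    is_min_value [set w : 'cV[R]_(8 * p) | (norm0 w <= k)%N]
      (regression_objective gamma Y (psi c X)) v /\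
    is_min_value (sparse_supports (8 * p) k)
      (support_objective gamma Y (psi c X)) v.
Proof.
split=> [s _|]; first exact: support_mx_unit.
exact: sparse_regression_min.
Qed.
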